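(* Let $n\ge 1$ and let $\pi,\sigma\in\mathfrak{B}_n$ be bigrassmannian permutations with length vectors $(\ell_1(\pi),\ell_2(\pi),\ell_3(\pi),\ell_4(\pi))$ and $(\ell_1(\sigma),\ell_2(\sigma),\ell_3(\sigma),\ell_4(\sigma))$. The following are equivalent: (1) $\pi\le\sigma$ in the Bruhat order; (2) $\ell_1(\pi)\ge\ell_1(\sigma)$, $\ell_4(\pi)\ge\ell_4(\sigma)$, $\ell_2(\pi)\le\ell_2(\sigma)$ and $\ell_3(\pi)\le\ell_3(\sigma)$.
   Context: $\mathfrak{S}_n$ is the set of permutations of $[n]=\{1,\dots,n\}$, written in one-line notation $\omega(1)\cdots\omega(n)$. A reduction of $\omega\in\mathfrak{S}_n$ is a permutation obtained by interchanging $\omega(i)$ and $\omega(j)$ for some $i<j$ with $\omega(i)>\omega(j)$. Bruhat order: $\pi\le\sigma$ if there is a (possibly trivial) chain $\sigma=\omega_1\to\cdots\to\omega_s=\pi$ with each $\omega_t$ a reduction of $\omega_{t-1}$. A permutation $\omega\in\mathfrak{S}_n$ is bigrassmannian (BG) if each of $\omega$ and $\omega^{-1}$ has exactly one descent (an index $i\in[n-1]$ with $\omega(i)>\omega(i+1)$, respectively $\omega^{-1}(i)>\omega^{-1}(i+1)$); $\mathfrak{B}_n$ is the set of BG permutations in $\mathfrak{S}_n$. Equivalently, $\omega\in\mathfrak{B}_n$ iff there is a (unique) triple $0\le a<b<c\le n$ with $\omega=1\cdots a\,(b+1)\cdots c\,(a+1)\cdots b\,(c+1)\cdots n$. The length vector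 of such an element is $(\ell_1,\ell_2,\ell_3,\ell_4)=(a+1,\,b-a,\,c-b,\,n+1-c)$. *)

(* Defs.v *)
From mathcomp Require Import all_boot all_fingroup.

Set Implicit Arguments.
Unset Strict Implicit.
Unset Printing Implicit Defensive.

(* Permutations of [n] are elements of 'S_n, acting on 'I_n = {0, ..., n-1}:
   position and value k of the usual one-line notation are both encoded by
   k - 1. *)

(* [(tperm i j * w)%g k = w (tperm i j k)], so this swaps the values of [w] at
   the positions [i] and [j]. *)
Definition reduction n : rel 'S_n := fun w w' =>
  [exists i : 'I_n, exists j : 'I_n,
    [&& i < j, w j < w i & w' == (tperm i j * w)%g]].

Definition bruhat_le n : rel 'S_n := fun p s => connect (@reduction n) s p.

Definition descents n (w : 'S_n) : {set 'I_n} :=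
  [set i : 'I_n | [exists j : 'I_n, (j == i.+1 :> nat) && (w j < w i)]].

Definition bigrassmannian n (w : 'S_n) : bool :=
  (#|descents w| == 1) && (#|descents w^-1%g| == 1).

Definition one_line n (w : 'S_n) : seq nat := [seq (w i).+1 | i <- enum 'I_n].

(* w = 1 ... a (b+1) ... c (a+1) ... b (c+1) ... n;
   [iota m k] is m, m+1, ..., m+k-1. *)
Definition block_form n (w : 'S_n) (a b c : nat) : bool :=
  [&& a < b, b < c, c <= n &
      one_line w ==
        iota 1 a ++ iota b.+1 (c - b) ++ iota a.+1 (b - a) ++ iota c.+1 (n - c)].

(* The default (0, 0, 0) is used only when [w] is not bigrassmannian; the
   triple is unique when it exists. *)
Definition bg_triple n (w : 'S_n) : nat * nat * nat :=
  if [pick t : 'I_n.+1 * 'I_n.+1 * 'I_n.+1 | block_form w t.1.1 t.1.2 t.2]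
    is Some (a, b, c) then (a : nat, b : nat, c : nat) else (0, 0, 0).

Definition ell1 n (w : 'S_n) : nat := let: (a, b, c) := bg_triple w in a + 1.
Definition ell2 n (w : 'S_n) : nat := let: (a, b, c) := bg_triple w in b - a.
Definition ell3 n (w : 'S_n) : nat := let: (a, b, c) := bg_triple w in c - b.
Definition ell4 n (w : 'S_n) : nat := let: (a, b, c) := bg_triple w in n + 1 - c.

(* Main.v *)
Require Import Defs.
From mathcomp Require Import all_boot all_fingroup.
From mathcomp Require Import zify.

(** Write [p = ell2], [q = ell3].  If [i < j] and [w j < w i], exchanging the
    values of [w] at [i] and [j] increases neither the largest [w i - i] nor
    the largest [i - w i], and it does not move the initial or final fixed
    points of [w].  On a bigrassmannian permutation these quantities are [p],
    [q], [ell1 - 1] and [ell4 - 1], so (1) implies (2).  Conversely (2) lets us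
    go from [sigma] to [pi] by steps that lower one of [p], [q] by one and
    raise one of [ell1], [ell4] by one.  Such a step carries the smallest value
    of one block leftwards across the other block, or the largest value
    rightwards, or is the inverse of such a move; it is therefore a chain of
    adjacent reductions. *)

(** * Block permutations and their inverses *)

Definition block_fun (a p q i : nat) : nat :=
  if i < a then i else if i < a + q then i + p
  else if i < a + q + p then i - q else i.

(** In the notation of [block_form], [b = a + p] and [c = a + p + q]. Either of [p], [q] may be 0,
    and then [w] is the identity. *)
Definition is_block {n} (w : 'S_n) (a p q : nat) : Prop :=
  a + p + q <= n /\ forall i : 'I_n, w i = block_fun a p q i :> nat.

Lemma block_fun_below a p q i : i < a -> block_fun a p q i = i.
Proof. by rewrite /block_fun => ->. Qed.

Lemma block_fun_left a p q i :
  a <= i -> i < a + q -> block_fun a p q i = i + p.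
Proof. by rewrite /block_fun; do ! case: ifP; lia. Qed.

Lemma block_fun_right a p q i :
  a + q <= i -> i < a + q + p -> block_fun a p q i = i - q.
Proof. by rewrite /block_fun; do ! case: ifP; lia. Qed.

Lemma block_fun_above a p q i : a + q + p <= i -> block_fun a p q i = i.
Proof. by rewrite /block_fun; do ! case: ifP; lia. Qed.

Lemma block_fun_lt n a p q i :
  a + p + q <= n -> i < n -> block_fun a p q i < n.
Proof. rewrite /block_fun; do ! case: ifP; lia. Qed.

Lemma block_funK a p q : cancel (block_fun a p q) (block_fun a q p).
Proof. move=> i; rewrite /block_fun; do ! case: ifP; lia. Qed.

Lemma is_block_exists n a p q :
  a + p + q <= n -> exists w : 'S_n, is_block w a p q.
Proof.
move=> le_n.
pose f (i : 'I_n) : 'I_n := Ordinal (block_fun_lt _ _ _ _ _ le_n (ltn_ord i)).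
have f_inj : injective f.
  move=> i j /(congr1 val) /= eq_f; apply: val_inj.
  exact: can_inj (block_funK a p q) _ _ eq_f.
by exists (perm f_inj); split=> // i; rewrite permE.
Qed.

Lemma is_block_eq n (w u : 'S_n) a p q :
  is_block w a p q -> is_block u a p q -> w = u.
Proof.
by move=> [_ hw] [_ hu]; apply/permP=> i; apply: val_inj; rewrite /= hw hu.
Qed.

(** Since inversion exchanges the two lengths, each move that lowers one of them yields a move that
    lowers the other. *)
Lemma is_block_inv n (w : 'S_n) a p q :
  is_block w a p q -> is_block w^-1%g a q p.
Proof.
move=> [le_n hw]; split=> [|i]; first by lia.
by rewrite -{2}(permKV w i) hw block_funK.
Qed.

(** * Bigrassmannian permutations are block permutations *)

Lemma homo_ltn_from (f : nat -> nat) lo hi :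
  (forall i, lo <= i -> i < hi -> f i < f i.+1) ->
  forall i j, lo <= i -> i < j -> j <= hi -> f i < f j.
Proof.
move=> mono_f i j lo_i; elim: j => // j IHj; rewrite ltnS leq_eqVlt.
case/predU1P=> [<-|lt_ij] j_hi; first exact: mono_f.
by apply: ltn_trans (IHj lt_ij (ltnW j_hi)) (mono_f _ _ _); lia.
Qed.

Lemma leq_from (f : nat -> nat) lo :
  lo <= f lo -> (forall i, lo <= i -> f i < f i.+1) ->
  forall i, lo <= i -> i <= f i.
Proof.
move=> f_lo mono_f; elim=> // i IHi; rewrite leq_eqVlt.
case/predU1P=> [<- //|lt_i]; have := mono_f i lt_i; have := IHi lt_i; lia.
Qed.

(** If [f] skipped the value [b + j + 1], the increasing [g] would have to place it strictly between
    the consecutive positions [a + j] and [a + j + 1]. *)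
Lemma two_monotone_run (f g : nat -> nat) a b x :
  cancel f g -> cancel g f -> f a = b ->
  (forall i, a <= i -> i.+1 < x -> f i < f i.+1) ->
  (forall v, b <= v -> g v < g v.+1) ->
  forall j, a + j < x -> f (a + j) = b + j.
Proof.
move=> fK gK fa mono_f mono_g; elim=> [|j IHj] lt_x; first by rewrite !addn0.
have fj := IHj ltac:(lia); have := mono_f (a + j) ltac:(lia) ltac:(lia).
rewrite -addnS fj => lt_f.
have lt_g v v' : b <= v -> v < v' -> g v < g v'.
  move=> b_v lt_v; apply: (homo_ltn_from g b v') => // i b_i _.
  exact: mono_g.
have g_j : g (b + j) = a + j by rewrite -fj fK.
have := lt_g (b + j) (b + j).+1 ltac:(lia) ltac:(lia).
rewrite g_j; case: (ltnP (b + j).+1 (f (a + j.+1))) => [lt_v|]; last by lia.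
by have := lt_g (b + j).+1 _ ltac:(lia) lt_v; rewrite fK; lia.
Qed.

Lemma two_monotone_run_below (f g : nat -> nat) a b x :
  cancel f g -> cancel g f -> f a = b ->
  (forall i, a <= i -> f i < f i.+1) ->
  (forall v, b <= v -> v.+1 < x -> g v < g v.+1) ->
  forall j, b + j < x -> f (a + j) = b + j.
Proof.
move=> fK gK fa mono_f mono_g j lt_x.
have ga : g b = a by rewrite -fa fK.
by rewrite -(two_monotone_run g f b a x gK fK ga mono_g mono_f j lt_x) gK.
Qed.

(** Let [a] be the least point moved, [b = f a] and [x = g a]. As everything below [a] is fixed,
    [f x = a] and [g b = a] are minimal among what remains, so the only descents of [f] and [g] are
    at [x - 1] and [b - 1]. This forces two runs of consecutive values, followed by the identity. *)
Lemma block_fun_of_descents (f g : nat -> nat) d e :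
  cancel f g -> cancel g f -> f d.+1 < f d ->
  (forall i, i != d -> f i < f i.+1) -> (forall v, v != e -> g v < g v.+1) ->
  exists a p q, [/\ 0 < p, 0 < q & f =1 block_fun a p q].
Proof.
move=> fK gK desc_f mono_f mono_g.
have f_inj := can_inj fK.
have exa : exists i, f i != i.
  (* If [d] is fixed, the descent gives [f d.+1 < d], so [d.+1] is moved. *)
  case: (eqVneq (f d) d) => [fd|]; last by exists d.
  by exists d.+1; apply/eqP; lia.
case: (ex_minnP exa) => a fa min_a.
have fix_a i : i < a -> f i = i.
  by move=> lt_i; apply/eqP; apply: contraLR lt_i => /min_a; rewrite -leqNgt.
have gfix_a i : i < a -> g i = i by move=> lt_i; rewrite -{1}(fix_a i lt_i) fK.
have f_ge i : a <= i -> a <= f i.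
  move=> le_i; rewrite leqNgt; apply/negP=> lt_f.
  by have := gfix_a _ lt_f; rewrite fK; lia.
have g_ge i : a <= i -> a <= g i.
  move=> le_i; rewrite leqNgt; apply/negP=> lt_g.
  by have := fix_a _ lt_g; rewrite gK; lia.
have a_b : a < f a by have := f_ge a (leqnn a); lia.
have ga : g a != a by apply/eqP=> ga; move/eqP: fa; rewrite -{1}ga gK.
have a_x : a < g a by have := g_ge a (leqnn a); lia.
set b := f a in a_b *; set x := g a in a_x *.
have fx : f x = a by rewrite gK.
have gb : g b = a by rewrite fK.
have d_x : d = x.-1.
  apply/eqP; rewrite eq_sym; apply/negPn/negP=> /mono_f.
  by rewrite prednK ?fx; [have := f_ge x.-1; lia | lia].
have e_b : e = b.-1.
  apply/eqP; rewrite eq_sym; apply/negPn/negP=> /mono_g.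
  by rewrite prednK ?gb; [have := g_ge b.-1; lia | lia].
have run1 j : a + j < x -> f (a + j) = b + j.
  by apply: (two_monotone_run f g) => // i *; [apply: mono_f | apply: mono_g]; lia.
have run2 j : a + j < b -> f (x + j) = a + j.
  apply: (two_monotone_run_below f g) => // i *; [apply: mono_f | apply: mono_g]; lia.
pose c := b + x - a.
(* The two runs fill exactly the positions and the values from [a] to [c - 1], so by injectivity [f]
   and [g] preserve what lies from [c] on. *)
have f_c i : c <= i -> c <= f i.
  move=> c_i; rewrite leqNgt; apply/negP=> f_lt.
  have := f_ge i ltac:(lia) => a_f; case: (ltnP (f i) b) => f_b.
    have := run2 (f i - a) ltac:(lia).
    by rewrite (_ : a + (f i - a) = f i); [move/f_inj; lia | lia].
  have := run1 (f i - b) ltac:(lia).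
  by rewrite (_ : b + (f i - b) = f i); [move/f_inj; lia | lia].
have g_c i : c <= i -> c <= g i.
  move=> c_i; rewrite leqNgt; apply/negP=> g_lt.
  have := g_ge i ltac:(lia) => a_g; case: (ltnP (g i) x) => g_x.
    have := run1 (g i - a) ltac:(lia).
    by rewrite (_ : a + (g i - a) = g i) ?gK; lia.
  have := run2 (g i - x) ltac:(lia).
  by rewrite (_ : x + (g i - x) = g i) ?gK; lia.
have fix_c i : c <= i -> f i = i.
  (* Growth of [g] at [f i] gives [f i <= g (f i) = i]; growth of [f] gives the converse. *)
  move=> c_i; apply/eqP; rewrite eqn_leq; apply/andP; split.
    rewrite -{2}(fK i); apply: (leq_from g c) (f_c _ c_i); first exact: g_c.
    by move=> v c_v; apply: mono_g; lia.
  apply: (leq_from f c) c_i; first exact: f_c.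
  by move=> v c_v; apply: mono_f; lia.
exists a, (b - a), (x - a); split; [lia | lia | move=> i].
rewrite /block_fun; case: ifP => [/fix_a //|a_i].
case: ifP => [i_x|x_i].
  by have := run1 (i - a) ltac:(lia); rewrite (_ : a + (i - a) = i); lia.
case: ifP => [i_c|c_i]; last by apply: fix_c; lia.
by have := run2 (i - x) ltac:(lia); rewrite (_ : x + (i - x) = i); lia.
Qed.

(* Extending by the identity beyond [n] creates no new descent. *)
Definition nat_perm {n} (w : 'S_n) (k : nat) : nat :=
  if insub k is Some i then w i : nat else k.

Lemma nat_perm_ord {n} (w : 'S_n) (i : 'I_n) : nat_perm w i = w i.
Proof. by rewrite /nat_perm valK. Qed.

Lemma nat_perm_ge {n} (w : 'S_n) k : n <= k -> nat_perm w k = k.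
Proof. by move=> le_k; rewrite /nat_perm insubN // -leqNgt. Qed.

Lemma nat_permK {n} (w : 'S_n) : cancel (nat_perm w) (nat_perm w^-1%g).
Proof.
move=> k; case: (ltnP k n) => [lt_k|le_k]; last by rewrite !nat_perm_ge.
by rewrite (nat_perm_ord w (Ordinal lt_k)) nat_perm_ord permK.
Qed.

Lemma nat_perm_descents1 n (w : 'S_n) :
  #|descents w| == 1 ->
  exists2 d, nat_perm w d.+1 < nat_perm w d &
    forall i, i != d -> nat_perm w i < nat_perm w i.+1.
Proof.
case/cards1P=> d desc_w; exists (d : nat).
  have: d \in descents w by rewrite desc_w set11.
  rewrite inE => /existsP[j /andP[/eqP <-]].
  by rewrite !nat_perm_ord.
move=> i; case: (ltnP i n) => [lt_i|le_i _]; last first.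
  by rewrite !nat_perm_ge // ltnW.
case: (ltnP i.+1 n) => [lt_i1|le_i1 _]; last first.
  rewrite (nat_perm_ge w i.+1) // (nat_perm_ord w (Ordinal lt_i)).
  by have := ltn_ord (w (Ordinal lt_i)); lia.
apply: contraNltn => le_w.
suff: Ordinal lt_i \in descents w by rewrite desc_w inE => /eqP <-.
rewrite inE; apply/existsP; exists (Ordinal lt_i1); rewrite eqxx /=.
move: le_w; rewrite (nat_perm_ord w (Ordinal lt_i)).
rewrite (nat_perm_ord w (Ordinal lt_i1)) leq_eqVlt => /predU1P[|//].
by move/val_inj/perm_inj/(congr1 val) => /=; lia.
Qed.

Lemma bigrassmannian_is_block n (w : 'S_n) :
  bigrassmannian w -> exists a p q, [/\ 0 < p, 0 < q & is_block w a p q].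
Proof.
case/andP=> /nat_perm_descents1[d desc_d mono_w].
case/nat_perm_descents1=> e _ mono_wV.
have wVK : cancel (nat_perm w^-1%g) (nat_perm w).
  by rewrite -{2}(invgK w); apply: nat_permK.
have [a [p [q [p0 q0 eq_w]]]] :=
  block_fun_of_descents _ _ _ _ (nat_permK w) wVK desc_d mono_w mono_wV.
exists a, p, q; split=> //; split=> [|i]; last by rewrite -nat_perm_ord eq_w.
(* Otherwise the last position of the second block is at least [n], hence fixed by the extension,
   whereas [block_fun] lowers it by [q > 0]. *)
rewrite leqNgt; apply/negP=> lt_n.
have := eq_w (a + p + q).-1; rewrite nat_perm_ge /block_fun; last by lia.
by do ! case: ifP; lia.
Qed.

(** The lists agree entry by entry once the 0-based values of [block_fun] are shifted by one. *)
Lemma block_formP n (w : 'S_n) a b c :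
  reflect [/\ a < b, b < c & is_block w a (b - a) (c - b)] (block_form w a b c).
Proof.
have block_seq : a < b -> b < c -> c <= n ->
    iota 1 a ++ iota b.+1 (c - b) ++ iota a.+1 (b - a) ++ iota c.+1 (n - c)
  = [seq (block_fun a (b - a) (c - b) (val i)).+1 | i <- enum 'I_n].
  move=> ab bc cn; rewrite [RHS](map_comp (fun k => (block_fun _ _ _ k).+1)).
  rewrite val_enum_ord; apply: (eq_from_nth (x0 := 0)) => [|i].
    by rewrite size_map !size_cat !size_iota; lia.
  rewrite !size_cat !size_iota => lt_i.
  rewrite (nth_map 0) ?size_iota ?nth_iota; try by lia.
  rewrite !nth_cat !size_iota /block_fun add0n.
  by do ! case: ifP; move=> *; rewrite nth_iota; lia.
apply: (iffP and4P) => [[ab bc cn]|[ab bc [cn hw]]].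
  rewrite block_seq // => /eqP/eq_in_map eq_w; split=> //; split; first by lia.
  by move=> i; have := eq_w i (mem_enum _ i) => -[].
have cn' : c <= n by lia.
split=> //; rewrite block_seq //; apply/eqP/eq_map => i; rewrite /= hw //.
Qed.

(** * Invariants of reductions *)

Lemma bruhat_le_ind n (P : 'S_n -> Prop) :
  (forall (w : 'S_n) (i j : 'I_n),
     i < j -> w j < w i -> P w -> P (tperm i j * w)%g) ->
  forall p s : 'S_n, bruhat_le p s -> P s -> P p.
Proof.
move=> stepP p s /connectP[r]; elim: r s => [|w r IHr] s /=; first by move=> _ ->.
case/andP=> /existsP[i /existsP[j /and3P[ij sji /eqP eq_w]]] path_r last_r Ps.
by apply: (IHr w) => //; rewrite eq_w; apply: stepP.
Qed.

Lemma bruhat_le_refl n (w : 'S_n) : bruhat_le w w.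
Proof. exact: connect0. Qed.

Lemma bruhat_le_trans {n} (u v w : 'S_n) :
  bruhat_le u v -> bruhat_le v w -> bruhat_le u w.
Proof. by move=> uv vw; apply: connect_trans vw uv. Qed.

Lemma bruhat_le_tperm n (w : 'S_n) (i j : 'I_n) :
  i < j -> w j < w i -> bruhat_le (tperm i j * w)%g w.
Proof.
move=> ij wji; apply: connect1; apply/existsP; exists i; apply/existsP.
by exists j; rewrite ij wji eqxx.
Qed.

(** Exchanging the values of [v] at [i < j] exchanges the values of its inverse at [v j < v i],
    which are [j] and [i]: again a reduction. *)
Lemma bruhat_le_inv n (u w : 'S_n) : bruhat_le u w -> bruhat_le u^-1%g w^-1%g.
Proof.
move=> le_uw.
apply: (bruhat_le_ind n (fun v => bruhat_le v^-1%g w^-1%g)) le_uw _; last first.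
  exact: bruhat_le_refl.
move=> v i j ij vji; apply: bruhat_le_trans.
rewrite invMg tpermV (_ : v^-1 * tperm i j = tperm (v j) (v i) * v^-1)%g.
  by apply: bruhat_le_tperm; rewrite ?permK.
by rewrite tpermC -tpermJ conjgE -!mulgA mulgV mulg1.
Qed.

(** After the exchange, position [i] holds the smaller value [w j], and position [j] holds
    [w i <= i + k < j + k]. *)
Lemma bruhat_le_excess n (p s : 'S_n) k : bruhat_le p s ->
  (forall i : 'I_n, s i <= i + k) -> forall i : 'I_n, p i <= i + k.
Proof.
apply: (bruhat_le_ind n (fun w => forall i : 'I_n, w i <= i + k)).
move=> w i j ij wji le_w x; rewrite permM.
by case: tpermP => [->|->|_ _]; have := le_w i; have := le_w x; lia.
Qed.

Lemma bruhat_le_deficiency n (p s : 'S_n) k : bruhat_le p s ->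
  (forall i : 'I_n, i <= s i + k) -> forall i : 'I_n, i <= p i + k.
Proof.
apply: (bruhat_le_ind n (fun w => forall i : 'I_n, i <= w i + k)).
move=> w i j ij wji le_w x; rewrite permM.
by case: tpermP => [->|->|_ _]; have := le_w j; have := le_w x; lia.
Qed.

(** A reduction cannot touch a position [i < a]: the smaller value [w j < w i = i] is itself a fixed
    point, so [w j = j] by injectivity, against [i < j]. *)
Lemma bruhat_le_fix_below n (p s : 'S_n) a : bruhat_le p s ->
  (forall i : 'I_n, i < a -> s i = i) -> forall i : 'I_n, i < a -> p i = i.
Proof.
apply: (bruhat_le_ind n (fun w => forall i : 'I_n, i < a -> w i = i)).
move=> w i j ij wji fix_w.
have a_i : a <= i.
  rewrite leqNgt; apply/negP=> i_a; rewrite (fix_w i i_a) in wji.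
  by have /perm_inj wj := fix_w (w j) (ltn_trans wji i_a); rewrite wj in wji; lia.
by move=> x x_a; rewrite permM tpermD ?fix_w // -val_eqE /=; lia.
Qed.

Lemma bruhat_le_fix_above n (p s : 'S_n) c : bruhat_le p s ->
  (forall i : 'I_n, c <= i -> s i = i) -> forall i : 'I_n, c <= i -> p i = i.
Proof.
apply: (bruhat_le_ind n (fun w => forall i : 'I_n, c <= i -> w i = i)).
move=> w i j ij wji fix_w.
have j_c : j < c.
  rewrite ltnNge; apply/negP=> c_j; rewrite (fix_w j c_j) in wji.
  have /perm_inj wi := fix_w (w i) (leq_trans c_j (ltnW wji)).
  by rewrite wi in wji; lia.
by move=> x x_c; rewrite permM tpermD ?fix_w // -val_eqE /=; lia.
Qed.

(** Each inequality is an invariant of [sigma] tested on [pi] where it is sharp: at [a], moved up by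
    [p], at [a + q], moved down by [q], or at the last moved position. *)
Lemma is_block_bruhat_le n (pi sigma : 'S_n) a p q a' p' q' :
  0 < p -> 0 < q -> is_block pi a p q -> is_block sigma a' p' q' ->
  bruhat_le pi sigma ->
  [/\ a' <= a, a + p + q <= a' + p' + q', p <= p' & q <= q'].
Proof.
move=> p0 q0 [le_n hpi] [_ hsigma] le_ps.
have lt_a : a < n by lia.
have lt_q : a + q < n by lia.
have lt_c : (a + p + q).-1 < n by lia.
have pi_a : pi (Ordinal lt_a) = a + p :> nat by rewrite hpi block_fun_left //=; lia.
have pi_q : pi (Ordinal lt_q) = a :> nat by rewrite hpi block_fun_right /=; lia.
have pi_c : pi (Ordinal lt_c) = a + p - 1 :> nat by rewrite hpi block_fun_right /=; lia.
split.
- rewrite leqNgt; apply/negP=> a_a'.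
  have fix_a (i : 'I_n) : i < a' -> sigma i = i.
    by move=> i_a; apply: val_inj; rewrite /= hsigma block_fun_below.
  have := bruhat_le_fix_below _ _ _ a' le_ps fix_a (Ordinal lt_a) a_a'.
  by move/(congr1 val); rewrite /= pi_a; lia.
- rewrite leqNgt; apply/negP=> c'_c.
  have fix_c (i : 'I_n) : a' + p' + q' <= i -> sigma i = i.
    by move=> i_c; apply: val_inj; rewrite /= hsigma block_fun_above //; lia.
  have := bruhat_le_fix_above _ _ _ (a' + p' + q') le_ps fix_c (Ordinal lt_c).
  by move/(_ ltac:(rewrite /=; lia))/(congr1 val); rewrite /= pi_c; lia.
- have excess (i : 'I_n) : sigma i <= i + p'.
    by rewrite hsigma /block_fun; do ! case: ifP; lia.
  have := bruhat_le_excess _ _ _ p' le_ps excess (Ordinal lt_a).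
  by rewrite pi_a /=; lia.
have deficiency (i : 'I_n) : i <= sigma i + q'.
  by rewrite hsigma /block_fun; do ! case: ifP; lia.
have := bruhat_le_deficiency _ _ _ q' le_ps deficiency (Ordinal lt_q).
by rewrite pi_q /=; lia.
Qed.

(** Reflexivity of the Bruhat order gives the four inequalities in both directions. *)
Lemma is_block_inj n (w : 'S_n) a p q a' p' q' :
  0 < p -> 0 < q -> 0 < p' -> 0 < q' ->
  is_block w a p q -> is_block w a' p' q' -> [/\ a = a', p = p' & q = q'].
Proof.
move=> p0 q0 p0' q0' hw hw'; have le_w := bruhat_le_refl _ w.
have [] := is_block_bruhat_le _ _ _ _ _ _ _ _ _ p0 q0 hw hw' le_w.
have [] := is_block_bruhat_le _ _ _ _ _ _ _ _ _ p0' q0' hw' hw le_w.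
by move=> *; split; lia.
Qed.

Lemma is_block_triple n (w : 'S_n) a p q :
  0 < p -> 0 < q -> is_block w a p q ->
  bg_triple w = (a, a + p, a + p + q).
Proof.
move=> p0 q0 hw; have le_n := hw.1; rewrite /bg_triple.
case: pickP => [[[x y] z] /= /block_formP[xy yz hw']|no].
  have [] := is_block_inj n w a p q _ _ _ p0 q0 _ _ hw hw'; try by lia.
  by move=> -> -> ->; congr (_, _, _); lia.
have := no (inord a, inord (a + p), inord (a + p + q)) => /= /negP[].
apply/block_formP; rewrite !inordK; try by lia.
by rewrite !addKn; split=> //; lia.
Qed.

(** * Carrying an extremal value across a block *)

(** The value [w y] travels left to [x] by adjacent exchanges, each a reduction because the value it
    passes is larger. The induction is on the distance [k]. *)
Lemma bruhat_le_rotate_min n k (w u : 'S_n) (x y : 'I_n) :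
  y = x + k :> nat ->
  (forall i : 'I_n, x <= i -> i < y -> w y < w i) ->
  u x = w y ->
  (forall i j : 'I_n, x <= i -> i < y -> j = i.+1 :> nat -> u j = w i) ->
  (forall i : 'I_n, (i < x) || (y < i) -> u i = w i) ->
  bruhat_le u w.
Proof.
elim: k w u x y => [|k IHk] w u x y yE min_y ux u_mid u_out.
  have xy : x = y by apply: val_inj; rewrite /= yE addn0.
  rewrite (_ : u = w) ?bruhat_le_refl //; apply/permP=> i.
  have [->|ne_i] := eqVneq i x; first by rewrite ux xy.
  by apply: u_out; move: ne_i; rewrite -val_eqE /= xy; lia.
have lt_z : y.-1 < n by have := ltn_ord y; lia.
pose z := Ordinal lt_z; have zE : z = y.-1 :> nat by [].
have w1 i : i != z -> i != y -> (tperm z y * w)%g i = w i.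
  by move=> ne_z ne_y; rewrite permM tpermD // eq_sym.
have w1z : (tperm z y * w)%g z = w y by rewrite permM tpermL.
have w1y : (tperm z y * w)%g y = w z by rewrite permM tpermR.
have le_w1 : bruhat_le (tperm z y * w)%g w.
  by apply: bruhat_le_tperm; [lia | apply: min_y; lia].
apply: bruhat_le_trans le_w1; apply: (IHk _ _ x z).
- by lia.
- move=> i x_i i_z; rewrite w1z w1 -?val_eqE /=; try by lia.
  by apply: min_y; lia.
- by rewrite w1z.
- move=> i j x_i i_z jE; rewrite w1 -?val_eqE /=; try by lia.
  by apply: u_mid; lia.
move=> i; have [->|ne_y] := eqVneq i y => i_out.
  by rewrite w1y; apply: u_mid; lia.
have i_y : i != y :> nat by rewrite val_eqE.
by rewrite w1 -?val_eqE /=; [apply: u_out | | ]; lia.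
Qed.

Lemma bruhat_le_rotate_max n k (w u : 'S_n) (x y : 'I_n) :
  y = x + k :> nat ->
  (forall i : 'I_n, x < i -> i <= y -> w i < w x) ->
  u y = w x ->
  (forall i j : 'I_n, x < i -> i <= y -> i = j.+1 :> nat -> u j = w i) ->
  (forall i : 'I_n, (i < x) || (y < i) -> u i = w i) ->
  bruhat_le u w.
Proof.
elim: k w u x y => [|k IHk] w u x y yE max_x uy u_mid u_out.
  have xy : x = y by apply: val_inj; rewrite /= yE addn0.
  rewrite (_ : u = w) ?bruhat_le_refl //; apply/permP=> i.
  have [->|ne_i] := eqVneq i y; first by rewrite uy xy.
  by apply: u_out; move: ne_i; rewrite -val_eqE /= xy; lia.
have lt_z : x.+1 < n by have := ltn_ord y; lia.
pose z := Ordinal lt_z; have zE : z = x.+1 :> nat by [].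
have w1 i : i != x -> i != z -> (tperm x z * w)%g i = w i.
  by move=> ne_x ne_z; rewrite permM tpermD // eq_sym.
have w1x : (tperm x z * w)%g x = w z by rewrite permM tpermL.
have w1z : (tperm x z * w)%g z = w x by rewrite permM tpermR.
have le_w1 : bruhat_le (tperm x z * w)%g w.
  by apply: bruhat_le_tperm; [lia | apply: max_x; lia].
apply: bruhat_le_trans le_w1; apply: (IHk _ _ z y).
- by lia.
- move=> i z_i i_y; rewrite w1z w1 -?val_eqE /=; try by lia.
  by apply: max_x; lia.
- by rewrite w1z.
- move=> i j z_i i_y iE; rewrite w1 -?val_eqE /=; try by lia.
  by apply: u_mid; lia.
move=> i; have [->|ne_x] := eqVneq i x => i_out.
  by rewrite w1x; apply: u_mid; lia.
have i_x : i != x :> nat by rewrite val_eqE.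
by rewrite w1 -?val_eqE /=; [apply: u_out | | ]; lia.
Qed.

(** * Single moves between block permutations *)

Lemma bruhat_le_raise_start n (w u : 'S_n) a p q :
  is_block w a p.+1 q -> is_block u a.+1 p q -> bruhat_le u w.
Proof.
move=> [le_n hw] [_ hu].
have lt_x : a < n by lia.
have lt_y : a + q < n by lia.
(* The value [a], first in the second block, crosses the [q] entries of the first block and becomes
   a fixed point. *)
apply: (bruhat_le_rotate_min _ q _ _ (Ordinal lt_x) (Ordinal lt_y)) => //=.
- by move=> i x_i i_y; rewrite !hw block_fun_right ?block_fun_left /=; lia.
- by apply: val_inj; rewrite /= hu hw block_fun_below ?block_fun_right /=; lia.
- move=> i j x_i i_y jE; apply: val_inj.
  by rewrite /= hu hw !block_fun_left /=; lia.
move=> i i_out; apply: val_inj; rewrite /= hu hw /block_fun.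
by do ! case: ifP; lia.
Qed.

Lemma bruhat_le_lower_end n (w u : 'S_n) a p q :
  is_block w a p q.+1 -> is_block u a p q -> bruhat_le u w.
Proof.
move=> [le_n hw] [_ hu].
have lt_x : a + q < n by lia.
have lt_y : a + q + p < n by lia.
(* The value [a + q + p], last in the first block, crosses the [p] entries of the second block and
   becomes a fixed point. *)
apply: (bruhat_le_rotate_max _ p _ _ (Ordinal lt_x) (Ordinal lt_y)) => //=.
- by move=> i x_i i_y; rewrite !hw block_fun_right ?block_fun_left /=; lia.
- by apply: val_inj; rewrite /= hu hw block_fun_above ?block_fun_left /=; lia.
- move=> i j x_i i_y iE; apply: val_inj.
  by rewrite /= hu hw !block_fun_right /=; lia.
move=> i i_out; apply: val_inj; rewrite /= hu hw /block_fun.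
by do ! case: ifP; lia.
Qed.

Lemma bruhat_le_raise_start_inv n (w u : 'S_n) a p q :
  is_block w a p q.+1 -> is_block u a.+1 p q -> bruhat_le u w.
Proof.
move=> /is_block_inv hw /is_block_inv hu; rewrite -(invgK u) -(invgK w).
exact/bruhat_le_inv/(bruhat_le_raise_start _ _ _ _ _ _ hw hu).
Qed.

Lemma bruhat_le_lower_end_inv n (w u : 'S_n) a p q :
  is_block w a p.+1 q -> is_block u a p q -> bruhat_le u w.
Proof.
move=> /is_block_inv hw /is_block_inv hu; rewrite -(invgK u) -(invgK w).
exact/bruhat_le_inv/(bruhat_le_lower_end _ _ _ _ _ _ hw hu).
Qed.

Lemma bruhat_le_is_block n (pi sigma : 'S_n) a p q a' p' q' :
  is_block pi a p q -> is_block sigma a' p' q' ->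
  a' <= a -> a + p + q <= a' + p' + q' -> p <= p' -> q <= q' ->
  bruhat_le pi sigma.
Proof.
move=> hpi; have [m] := ubnP (p' - p + (q' - q)).
elim: m sigma a' p' q' => // m IHm sigma a' p' q' lt_m hsigma a_a c_c p_p q_q.
have [le_n _] := hsigma.
have step a1 p1 q1 : a1 + p1 + q1 <= n ->
    (forall u : 'S_n, is_block u a1 p1 q1 -> bruhat_le u sigma) ->
    p1 - p + (q1 - q) < m -> a1 <= a -> a + p + q <= a1 + p1 + q1 ->
    p <= p1 -> q <= q1 -> bruhat_le pi sigma.
  move=> /is_block_exists[u hu] le_u *; apply: bruhat_le_trans (le_u u hu).
  exact: (IHm _ _ _ _ _ hu).
(* While [a' < a], the start is raised and the end kept. Once [a' = a], lowering the end is safe,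
   since the bounds on [p] and [q] alone imply the one on the ends. *)
have [lt_a|ge_a] := ltnP a' a; have [lt_p|ge_p] := ltnP p p'.
- case: p' => // p' in hsigma lt_m c_c p_p le_n lt_p *.
  apply: (step a'.+1 p' q') => [|u hu|||||]; try by lia.
  exact: bruhat_le_raise_start hsigma hu.
(* Here [p' = p] and [a' < a], so the inequality between the ends forces [q < q']. *)
- case: q' => [|q'] in hsigma lt_m c_c q_q le_n *; first by lia.
  apply: (step a'.+1 p' q') => [|u hu|||||]; try by lia.
  exact: bruhat_le_raise_start_inv hsigma hu.
- case: p' => // p' in hsigma lt_m c_c p_p le_n lt_p *.
  apply: (step a' p' q') => [|u hu|||||]; try by lia.
  exact: bruhat_le_lower_end_inv hsigma hu.
have [lt_q|ge_q] := ltnP q q'; last first.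
  have [aE pE qE] : [/\ a' = a, p' = p & q' = q] by split; lia.
  rewrite (is_block_eq _ pi sigma a p q) ?bruhat_le_refl //.
  by rewrite -aE -pE -qE.
case: q' => // q' in hsigma lt_m c_c q_q le_n lt_q *.
apply: (step a' p' q') => [|u hu|||||]; try by lia.
exact: bruhat_le_lower_end hsigma hu.
Qed.

Theorem theorem1p2 (n : nat) (hn : 1 <= n) (pi sigma : 'S_n)
    (hpi : bigrassmannian pi) (hsigma : bigrassmannian sigma) :
  bruhat_le pi sigma <->
  [/\ ell1 pi >= ell1 sigma, ell4 pi >= ell4 sigma,
      ell2 pi <= ell2 sigma & ell3 pi <= ell3 sigma].
Proof.
have [a [p [q [p0 q0 bpi]]]] := bigrassmannian_is_block _ _ hpi.
have [a' [p' [q' [p0' q0' bsigma]]]] := bigrassmannian_is_block _ _ hsigma.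
(* These bounds keep the truncated subtraction in [ell4] exact, so comparing [ell4] amounts to
   comparing the ends of the blocks. *)
have [le_n _] := bpi; have [le_n' _] := bsigma.
rewrite /ell1 /ell2 /ell3 /ell4.
rewrite (is_block_triple _ _ _ _ _ p0 q0 bpi).
rewrite (is_block_triple _ _ _ _ _ p0' q0' bsigma).
split=> [le_ps|[le1 le4 le2 le3]].
  have [] := is_block_bruhat_le _ _ _ _ _ _ _ _ _ p0 q0 bpi bsigma le_ps.
  by split; lia.
by apply: (bruhat_le_is_block _ _ _ _ _ _ _ _ _ bpi bsigma); lia.
Qed.
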